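(* Let $n\ge1$, let $C_{\lambda,\mu}$ be a conjugacy class of $B_n$, let $B_n(t)=\sum_{\omega\in B_n}t^{\operatorname{des}_B(\omega)+1}$ (with $B_0(t)=t$) and $B_{\lambda,\mu}(t)=\sum_{\omega\in C_{\lambda,\mu}}t^{\operatorname{des}_B(\omega)+1}$. Then there is a polynomial $g(t)$ such that \[\frac{B_{\lambda,\mu}(t)}{|C_{\lambda,\mu}|}=\frac{B_n(t)}{2^nn!}+\frac{1-t}{2n}\cdot\frac{B_{n-1}(t)}{2^{n-1}(n-1)!}\,\Delta^2(\lambda,\mu)+(1-t)^2g(t).\]
   Context: $B_n$ is the group of permutations $\omega$ of $\{\pm1,\dots,\pm n\}$ with $\omega(-i)=-\omega(i)$ (order $2^nn!$); $\operatorname{des}_B(\omega)=|\{i\in\{0,\dots,n-1\}:\omega(i)>\omega(i+1)\}|$ with $\omega(0)=0$. A cycle of $\omega$ is a cycle of $|\omega|:i\mapsto|\omega(i)|$; it is even (odd) if the number of its elements $i$ with $\omega(i)<0$ is even (odd). The cycle type is the bi-partition $(\lambda,\mu)$ with $\lambda$ the lengths of even cycles, $\mu$ those of odd cycles, and $C_{\lambda,\mu}$ is the conjugacy class of that type. $\Delta^2(\lambda,\mu)=m_1(\lambda)^2-m_1(\mu)^2$, where $m_1(\cdot)$ is the number of parts equal to $1$. *)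

(* Defs.v *)
From HB Require Import structures.
From mathcomp Require Import all_boot all_order all_algebra all_fingroup.

Set Implicit Arguments.
Unset Strict Implicit.
Unset Printing Implicit Defensive.

Import Order.TTheory GRing.Theory Num.Theory.
Local Open Scope ring_scope.

(* {±1, ..., ±n}: (i, b) stands for the integer (-1)^b (i + 1). *)
Definition spoint (n : nat) : finType := ('I_n * bool)%type.

Definition spoint_int (n : nat) (x : spoint n) : int :=
  (-1) ^+ x.2 * (x.1.+1)%:Z.

Definition spoint_opp (n : nat) (x : spoint n) : spoint n := (x.1, ~~ x.2).

Lemma spoint_int_inj (n : nat) : injective (@spoint_int n).
Proof.
move=> [[i Hi] b] [[j Hj] c]; rewrite /spoint_int /= => E.
have Eij : i = j.
  by case: b c E => [] [] /=; rewrite ?expr0 ?expr1 ?mulN1r ?mul1r => - [].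
move: E; rewrite -{}Eij in Hj *; rewrite (bool_irrelevance Hj Hi).
by case: b c => [] [].
Qed.

Lemma spoint_int_opp (n : nat) (x : spoint n) :
  spoint_int (spoint_opp x) = - spoint_int x.
Proof.
by case: x => i [] /=; rewrite /spoint_int /= ?expr0 ?expr1 ?mulN1r ?mul1r ?opprK.
Qed.

Definition hyperoct_set (n : nat) : {set {perm spoint n}} :=
  [set w : {perm spoint n} | [forall x, w (spoint_opp x) == spoint_opp (w x)]].

Lemma hyperoct_group_set (n : nat) : group_set (hyperoct_set n).
Proof.
apply/group_setP; split=> [|u v].
  by rewrite inE; apply/forallP=> x; rewrite !perm1.
rewrite !inE => /forallP Hu /forallP Hv; apply/forallP=> x.
by rewrite !permM (eqP (Hu x)) (eqP (Hv _)).
Qed.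

Canonical hyperoct (n : nat) : {group {perm spoint n}} :=
  group (hyperoct_group_set n).

(* k |-> w(k) for 0 <= k <= n, with w(0) = 0; k > n is a junk case. *)
Definition window (n : nat) (w : {perm spoint n}) (k : nat) : int :=
  if k is j.+1 then
    if insub j is Some i then spoint_int (w (i, false)) else 0
  else 0.

Definition desB (n : nat) (w : {perm spoint n}) : nat :=
  #|[set i : 'I_n | window w i > window w i.+1]|.

Definition absfun (n : nat) (w : {perm spoint n}) (i : 'I_n) : 'I_n :=
  (w (i, false)).1.

Lemma absfun_inj (n : nat) (w : {perm spoint n}) :
  w \in hyperoct n -> injective (absfun w).
Proof.
rewrite inE => /forallP Hw i j; rewrite /absfun => E.
have /orP[/eqP|/eqP] : (w (i, false) == w (j, false))
                    || (w (i, false) == spoint_opp (w (j, false))).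
- move: E; case: (w (i, false)) (w (j, false)) => [a b] [c d] /= ->.
  by rewrite /spoint_opp -!pair_eqE /= eqxx; case: b d => [] [].
- by move/perm_inj => [].
- by rewrite -(eqP (Hw _)) => /perm_inj.
Qed.

(* On hyperoct n, absfun w is a bijection, so these are its cycles as sets
   (fixed points included). *)
Definition cycles (n : nat) (w : {perm spoint n}) : {set {set 'I_n}} :=
  [set [set j | fconnect (absfun w) i j] | i : 'I_n].

Definition odd_cycle (n : nat) (w : {perm spoint n}) (c : {set 'I_n}) : bool :=
  odd #|[set i in c | spoint_int (w (i, false)) < 0]|.

(* Partitions are represented by their weakly decreasing lists of parts. *)
Definition cycle_type (n : nat) (w : {perm spoint n}) : seq nat * seq nat :=
  (sort geq [seq #|c| | c : {set 'I_n} <- enum (cycles w) & ~~ odd_cycle w c],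
   sort geq [seq #|c| | c : {set 'I_n} <- enum (cycles w) & odd_cycle w c]).

Definition class_of_type (n : nat) (C : {set {perm spoint n}})
    (lambda mu : seq nat) : Prop :=
  C \in classes (hyperoct n) /\
  exists2 w : {perm spoint n}, w \in C & cycle_type w = (lambda, mu).

Definition m1 (lambda : seq nat) : nat := count_mem 1%N lambda.

Definition Delta2 (lambda mu : seq nat) : int :=
  (m1 lambda)%:Z ^+ 2 - (m1 mu)%:Z ^+ 2.

Definition des_poly (n : nat) (S : {set {perm spoint n}}) : {poly rat} :=
  \sum_(w in S) 'X^((desB w).+1).

Definition eulerB (n : nat) : {poly rat} := des_poly (hyperoct n).

Lemma eulerB0 : eulerB 0 = 'X.
Proof.
have all1 (w : {perm spoint 0}) : w = 1%g by apply/permP => -[[]].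
rewrite /eulerB /des_poly (big_pred1 1%g) => [|w]; last first.
  by rewrite (all1 w) /= eqxx; apply: group1.
rewrite (_ : desB _ = 0%N) ?expr1 //.
by apply: eq_card0 => -[].
Qed.

(* Main.v *)
Require Import Defs.
From mathcomp Require Import all_boot all_order all_algebra all_fingroup.
From mathcomp Require Import zify ring.

(* A polynomial is a multiple of (1 - t)^2 iff it and its derivative vanish at
   t = 1, so the claim is about the mean of des_B: it is n/2 over B_n (negate
   all values) and n/2 - (a^2 - b^2)/(2n) over a class whose elements have a
   positive and b negative fixed points.  For the latter, pair w with its
   conjugate by the sign change of 1 for the descent at 0, and by the
   transposition (i i+1) for the descent at i >= 1.  Exactly one element of the
   pair has the descent, except when w(1) = 1 or -1, resp. when w maps {i, i+1}
   onto {i, i+1} or {-i, -(i+1)}; then w and its conjugate agree there.  As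
   w(i) = i+1, w(i+1) = i and w(i) = -(i+1), w(i+1) = -i are equally frequent,
   only the events w = +1 or w = -1 on the given points count, with frequencies
   a/n and b/n, resp. a(a-1)/(n(n-1)) and b(b-1)/(n(n-1)). *)

Set Implicit Arguments.
Unset Strict Implicit.
Unset Printing Implicit Defensive.

Import Order.TTheory GRing.Theory Num.Theory.
Local Open Scope ring_scope.

(** * Signed permutations, their signed fixed points, and the parts of size 1 of the cycle type *)

Section SignedPerm.
Variable n : nat.
Implicit Types (w h : {perm spoint n}) (x y : spoint n) (s : bool).

(** Wreath product coordinates on B_n: [sigma] is |w|, and [f i] tells whether the value of [w] at
    the positive point [i] is negative. *)
Definition signed_fun (sigma : {perm 'I_n}) (f : {ffun 'I_n -> bool}) x :
    spoint n :=
  (sigma x.1, x.2 (+) f x.1).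

Lemma signed_fun_inj sigma f : injective (signed_fun sigma f).
Proof.
move=> [i b] [j c] [] /perm_inj -> /= E; congr (_, _).
exact: addIb E.
Qed.

Definition signed_perm sigma f : {perm spoint n} :=
  perm (@signed_fun_inj sigma f).

Lemma signed_permE sigma f x :
  signed_perm sigma f x = (sigma x.1, x.2 (+) f x.1).
Proof. by rewrite permE. Qed.

Lemma mem_signed_perm sigma f : signed_perm sigma f \in hyperoct n.
Proof.
rewrite inE; apply/forallP=> x; rewrite !signed_permE /spoint_opp /=.
by rewrite addNb.
Qed.

Definition twist s x : spoint n := (x.1, x.2 (+) s).

Lemma twist_inj s : injective (twist s).
Proof. by move=> [i b] [j c] [] -> /addIb ->. Qed.

Lemma hyperoct_twist w s x : w \in hyperoct n -> w (twist s x) = twist s (w x).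
Proof.
rewrite inE /twist => /forallP /(_ x) /eqP.
case: x => i b; case: s; rewrite /spoint_opp /= ?addbT //.
by rewrite !addbF -surjective_pairing.
Qed.

Lemma signed_perm_surj w : w \in hyperoct n ->
  exists sigma f, w = signed_perm sigma f.
Proof.
move=> Gw; exists (perm (absfun_inj Gw)), [ffun i => (w (i, false)).2].
apply/permP=> -[i b]; rewrite signed_permE /= permE ffunE.
rewrite (_ : (i, b) = twist b (i, false)) // hyperoct_twist //.
by rewrite /twist addbC.
Qed.

Lemma signed_perm_inj :
  injective (fun p : {perm 'I_n} * {ffun 'I_n -> bool} => signed_perm p.1 p.2).
Proof.
move=> [s f] [t g] /= /permP E; congr (_, _).
  by apply/permP=> i; have := E (i, false); rewrite !signed_permE => -[].
by apply/ffunP=> i; have := E (i, false); rewrite !signed_permE => -[].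
Qed.

Lemma card_hyperoct : #|hyperoct n| = (2 ^ n * n`!)%N.
Proof.
have -> : hyperoct n = [set signed_perm p.1 p.2
    | p in [set: {perm 'I_n} * {ffun 'I_n -> bool}]] :> {set _}.
  apply/setP=> w; apply/idP/imsetP=> [/signed_perm_surj [s [f ->]]|[p _ ->]].
    by exists (s, f).
  exact: mem_signed_perm.
rewrite (card_imset _ signed_perm_inj) cardsT card_prod card_ffun card_bool.
by rewrite card_ord card_Sn mulnC.
Qed.

(** The sign [s] lets one argument serve both w(i) = i ([false]) and w(i) = -i ([true]). *)
Definition fixes w s i : bool := w (i, false) == (i, s).

Definition nfix s w : nat := #|[set i | fixes w s i]|.

(** Since [w] and [h] commute with negation, the sign that [h] gives to [i] enters on both sides of
    the equation and cancels. *)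
Lemma fixes_conj w h s i : w \in hyperoct n -> h \in hyperoct n ->
  fixes (w ^ h)%g s (absfun h i) = fixes w s i.
Proof.
move=> Gw Gh; rewrite /fixes /absfun.
have Gwh : (w ^ h)%g \in hyperoct n by rewrite groupJ.
set y := h (i, false).
have -> : (y.1, false) = twist y.2 y by rewrite /twist addbb.
have -> : (y.1, s) = twist y.2 (twist s y).
  by rewrite /twist /= addbAC addbb.
rewrite hyperoct_twist // /y permJ (inj_eq (@twist_inj _)) -hyperoct_twist //.
by rewrite (inj_eq perm_inj).
Qed.

Lemma nfix_conj w h s : w \in hyperoct n -> h \in hyperoct n ->
  nfix s (w ^ h)%g = nfix s w.
Proof.
move=> Gw Gh; rewrite /nfix -[RHS](card_imset _ (absfun_inj Gh)); apply: eq_card.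
move=> j; rewrite inE; apply/esym.
 apply/imsetP/idP=> [[i]|Hj].
  by rewrite inE => Hi ->; rewrite fixes_conj.
have [g _ hg] := injF_bij (absfun_inj Gh).
by exists (g j); rewrite ?hg // inE -(fixes_conj _ _ Gw Gh) // hg.
Qed.

Lemma odd_cycle1 w i : odd_cycle w [set i] = (w (i, false)).2.
Proof.
rewrite /odd_cycle.
have -> : [set j in [set i] | spoint_int (w (j, false)) < 0] =
          if (w (i, false)).2 then [set i] else set0.
  apply/setP=> j; rewrite !inE; case: eqVneq => [->|ne] /=; last first.
    by case: ifP; rewrite !inE ?(negPf ne).
  rewrite /spoint_int; case: (w (i, false)) => k [] /=; rewrite !inE ?eqxx; lia.
by case: ifP; rewrite ?cards1 ?cards0.
Qed.

Lemma cycles1 w i : ([set i] \in cycles w) = (absfun w i == i).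
Proof.
apply/imsetP/eqP=> [[j _ E]|E].
  have := set11 i; rewrite E inE => ji.
  have : j \in [set i] by rewrite E inE connect0.
  rewrite inE => /eqP ej; subst j.
  by apply/eqP; rewrite -in_set1 E inE fconnect1.
exists i => //; apply/setP=> j; rewrite !inE.
apply/eqP/idP=> [->|/iter_findex <-]; first by rewrite connect0.
by elim: (findex _ _ _) => //= k ->.
Qed.

Lemma fixesE w s i : fixes w s i = (absfun w i == i) && ((w (i, false)).2 == s).
Proof. by rewrite /fixes /absfun -pair_eqE. Qed.

(** A part 1 is a singleton cycle, that is a fixed point of |w|, and the parity of that cycle is the
    sign of [w] there; hence [i] -> [[set i]] is a bijection between the two sets counted. *)
Lemma count_parts1 w (P : pred {set 'I_n}) s :
  (forall i, P [set i] = ((w (i, false)).2 == s)) ->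
  m1 (sort geq [seq #|c| | c : {set 'I_n} <- enum (cycles w) & P c]) = nfix s w.
Proof.
move=> HP; rewrite /m1 count_sort count_map count_filter.
set Q := predI _ _; have {HP} HQ i : [set i] \in cycles w -> Q [set i] = fixes w s i.
  by rewrite cycles1 fixesE /Q /= cards1 HP => ->.
rewrite /nfix -(card_imset _ set1_inj) -size_filter cardE /enum_mem -filter_predI.
congr size; apply: eq_filter => c /=.
apply/andP/imsetP=> [[Qc]|[i]].
  move: (Qc) => /andP[/cards1P [i Ec] _] cy.
  by exists i => //; rewrite inE -HQ -Ec.
rewrite inE => Fi ->; have ci : [set i] \in cycles w.
  by rewrite cycles1; move: Fi; rewrite fixesE => /andP[].
by split=> //; have := HQ i ci; rewrite Fi.
Qed.

Lemma m1_cycle_type w : m1 (cycle_type w).1 = nfix false w /\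
  m1 (cycle_type w).2 = nfix true w.
Proof.
split; apply: (@count_parts1 w (fun c => _)) => i; rewrite odd_cycle1.
  by rewrite eqbF_neg.
by rewrite eqb_id.
Qed.

End SignedPerm.

(** * Sums over a conjugacy class and frequencies of signed fixed points *)

Section ConjSums.
Variable n : nat.
Implicit Types (w h : {perm spoint n}) (x y : spoint n) (s : bool).
Variable C : {set {perm spoint n}}.
Hypothesis CG : C \in classes (hyperoct n).

Lemma class_hyperoct w : w \in C -> w \in hyperoct n.
Proof.
have /repr_classesP [Gr ->] := CG.
by apply/subsetP; rewrite class_subG.
Qed.

Lemma sum_conj (f : {perm spoint n} -> nat) h : h \in hyperoct n ->
  (\sum_(w in C) f (w ^ h)%g = \sum_(w in C) f w)%N.
Proof.
move=> Gh; rewrite [RHS](reindex_inj (conjg_inj h)) /=; apply: eq_bigl => w.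
have /repr_classesP [_ ->] := CG.
by rewrite -[in RHS](classGidr _ Gh) memJ_conjg.
Qed.

Lemma nfix_class s w v : w \in C -> v \in C -> nfix s w = nfix s v.
Proof.
move=> Cw Cv; have Gv := class_hyperoct Cv.
move: Cw Cv; have /repr_classesP [_ ->] := CG => Cw; rewrite class_sym => Cv.
have /imsetP [h Gh ->] := class_trans Cw Cv.
exact: nfix_conj.
Qed.

Definition numfix s i := (\sum_(w in C) fixes w s i)%N.
Definition numfix2 s i j := (\sum_(w in C) (fixes w s i && fixes w s j))%N.

Lemma absfun_signed_perm sigma (f : {ffun 'I_n -> bool}) i :
  absfun (signed_perm sigma f) i = sigma i.
Proof. by rewrite /absfun signed_permE. Qed.

Lemma numfix_perm s (sigma : {perm 'I_n}) i : numfix s (sigma i) = numfix s i.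
Proof.
have Gh := mem_signed_perm sigma [ffun=> false].
rewrite /numfix -(sum_conj _ Gh); apply: eq_bigr => w Cw.
by rewrite -(absfun_signed_perm sigma [ffun=> false]) fixes_conj // class_hyperoct.
Qed.

Lemma numfix2_perm s (sigma : {perm 'I_n}) i j :
  numfix2 s (sigma i) (sigma j) = numfix2 s i j.
Proof.
have Gh := mem_signed_perm sigma [ffun=> false].
rewrite /numfix2 -(sum_conj _ Gh); apply: eq_bigr => w Cw.
by rewrite -!(absfun_signed_perm sigma [ffun=> false]) !fixes_conj // class_hyperoct.
Qed.

Lemma numfix_const s i j : numfix s i = numfix s j.
Proof. by rewrite -(numfix_perm s (tperm i j)) tpermL. Qed.

(** The symmetric group is 2-transitive: one transposition moves [i] to [i'], a second one then
    moves the image of [j] to [j'] while keeping [i']. *)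
Lemma numfix2_const s i j i' j' : i != j -> i' != j' ->
  numfix2 s i j = numfix2 s i' j'.
Proof.
move=> ij ij'; rewrite -(numfix2_perm s (tperm i i')) tpermL.
set k := tperm i i' j; have ki : k != i'.
  by rewrite -[X in _ != X](tpermL i i') (inj_eq perm_inj) eq_sym.
rewrite -(numfix2_perm s (tperm k j')) tpermL tpermD //.
by rewrite eq_sym.
Qed.

(** Double counting of the pairs (v, j) with v in [C] and j fixed by v with sign [s]. *)
Lemma numfix_total s i w : w \in C ->
  (n * numfix s i = #|C| * nfix s w)%N.
Proof.
move=> Cw; transitivity (\sum_(j : 'I_n) numfix s j)%N.
  by rewrite (eq_bigr _ (fun j _ => numfix_const s j i)) sum_nat_const card_ord.
rewrite exchange_big /= -sum_nat_const; apply: eq_bigr => v Cv.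
rewrite (nfix_class s Cw Cv) /nfix -sum1dep_card [RHS]big_mkcond /=.
by apply: eq_bigr => j _; case: fixes.
Qed.

(** The same double counting with ordered pairs of distinct fixed points. *)
Lemma numfix2_total s i j w : w \in C -> i != j ->
  (n * n.-1 * numfix2 s i j = #|C| * (nfix s w * (nfix s w).-1))%N.
Proof.
move=> Cw ij; transitivity (\sum_(k : 'I_n) \sum_(l | l != k) numfix2 s k l)%N.
  rewrite (eq_bigr (fun=> n.-1 * numfix2 s i j)%N); last first.
    move=> k _; rewrite (eq_bigr (fun=> numfix2 s i j)); last first.
      by move=> l lk; apply: numfix2_const; rewrite // eq_sym.
    by rewrite sum_nat_const cardC1 card_ord.
  by rewrite sum_nat_const card_ord mulnA.
rewrite (eq_bigr (fun k => \sum_(v in C) \sum_(l | l != k)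
    (fixes v s k && fixes v s l))%N); last first.
  by move=> k _; rewrite exchange_big.
rewrite exchange_big /= -sum_nat_const; apply: eq_bigr => v Cv.
rewrite (nfix_class s Cw Cv) /nfix; set F := [set i | _].
rewrite -sum_nat_const [RHS]big_mkcond /=; apply: eq_bigr => k _.
rewrite inE; case: ifP => Fk; last by rewrite big1.
rewrite (cardsD1 k F) inE Fk /= -sum1_card [RHS]big_mkcond [LHS]big_mkcond /=.
apply: eq_bigr => l _; rewrite !inE; case: (l != k) => //=.
Qed.

End ConjSums.

(** * Comparison of signed values and the effect of an adjacent transposition *)

Section Descents.
Variable n : nat.
Implicit Types (w h : {perm spoint n}) (x y : spoint n) (s : bool).

Lemma spoint_lt x y : (spoint_int x < spoint_int y) =
  if x.2 then (if y.2 then y.1 < x.1 else true)%N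
  else (if y.2 then false else x.1 < y.1)%N.
Proof.
case: x y => [i b] [j c]; rewrite /spoint_int /=.
by case: b; case: c => /=; rewrite ?expr0 ?expr1 ?mulN1r ?mul1r; lia.
Qed.

Lemma spoint_lt0 x : (spoint_int x < 0) = x.2.
Proof.
case: x => [i b]; rewrite /spoint_int /=.
by case: b => /=; rewrite ?expr0 ?expr1 ?mulN1r ?mul1r; lia.
Qed.

Lemma windowS w (i : 'I_n) : window w i.+1 = spoint_int (w (i, false)).
Proof. by rewrite /window valK. Qed.

Definition swap (i j : 'I_n) x : spoint n := (tperm i j x.1, x.2).

(** Exchanging the adjacent absolute values [i] and [j] preserves the order of [x] and [y] unless
    these are the two values and have equal signs. In those four cases the two comparisons are both
    false (extra term on the left) or both true (extra term on the right). *)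
Lemma lt_swap (i j : 'I_n) x y : j = i.+1 :> nat -> x.1 != y.1 ->
  ((spoint_int y < spoint_int x)%R
   + (spoint_int (swap i j x) < spoint_int (swap i j y))%R
   + ((x == (i, false)) && (y == (j, false)))
   + ((x == (j, true)) && (y == (i, true)))
  = 1 + ((x == (i, true)) && (y == (j, true)))
   + ((x == (j, false)) && (y == (i, false))))%N.
Proof.
case: x y => [a b] [c e] /= ij ac; rewrite !spoint_lt /swap /= -!pair_eqE /=.
have tE k : tperm i j k = (if k == i :> nat then j : nat
    else if k == j :> nat then i : nat else k) :> nat.
  by rewrite permE /= !val_eqE; case: (k == i); case: (k == j).
rewrite !tE; move: ac; rewrite -!val_eqE /= ij => ac.
by case: b; case: e => /=; rewrite ?andbF ?andbT /=;
  repeat case: ifP => ?; lia.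
Qed.

End Descents.

(** * The number of class elements with a descent at a given position *)

Section DescentSums.
Variables (n : nat) (C : {set {perm spoint n}}).
Hypothesis CG : C \in classes (hyperoct n).
Implicit Types w : {perm spoint n}.

Let flip (i : 'I_n) := signed_perm 1%g [ffun k => k == i].

(** Conjugation by the sign change of [i] reverses the sign of w(i), except when w(i) is [i] or
    [-i], where the value stays. *)
Lemma sum_neg_value (i : 'I_n) :
  (2 * \sum_(w in C) (w (i, false)).2 + numfix C false i
   = #|C| + numfix C true i)%N.
Proof.
have Gh : flip i \in hyperoct n := mem_signed_perm _ _.
rewrite mul2n -addnn -{2}(sum_conj CG _ Gh) -sum1_card -!big_split /=.
apply: eq_bigr => w /(class_hyperoct CG) Gw.
have E : (i, false) = flip i (twist true (i, false)).
  by rewrite signed_permE perm1 ffunE /= eqxx.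
rewrite {2}E permJ hyperoct_twist // signed_permE ffunE /fixes.
by case: (w (i, false)) => k c; rewrite /= -!pair_eqE /=; case: (k == i); case: c.
Qed.

(** Conjugation by the sign change of [j] turns one event into the other. *)
Lemma sum_swapped (i j : 'I_n) : i != j ->
  (\sum_(w in C) ((w (i, false) == (j, true)) && (w (j, false) == (i, true)))
   = \sum_(w in C)
       ((w (i, false) == (j, false)) && (w (j, false) == (i, false))))%N.
Proof.
move=> ij; have Gh : flip j \in hyperoct n := mem_signed_perm _ _.
rewrite -[RHS](sum_conj CG _ Gh); apply: eq_bigr => w /(class_hyperoct CG) Gw.
have fi : flip j (i, false) = (i, false).
  by rewrite signed_permE perm1 ffunE (negPf ij).
have fj : flip j (j, true) = (j, false).
  by rewrite signed_permE perm1 ffunE eqxx.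
have -> : ((w ^ flip j)%g (i, false) == (j, false))
        = (w (i, false) == (j, true)).
  by rewrite -{1}fi -fj permJ (inj_eq perm_inj).
have -> : ((w ^ flip j)%g (j, false) == (i, false))
        = (w (j, true) == (i, false)).
  by rewrite -{1}fj -{1}fi permJ (inj_eq perm_inj).
rewrite -[w (j, true) == _](inj_eq (@twist_inj _ true)) -hyperoct_twist //.
Qed.

Lemma sum_descent (i j : 'I_n) : j = i.+1 :> nat ->
  (2 * \sum_(w in C) (spoint_int (w (j, false)) < spoint_int (w (i, false)))%R
   + numfix2 C false i j = #|C| + numfix2 C true i j)%N.
Proof.
move=> ij; have ij' : i != j by rewrite -val_eqE /= ij; lia.
have Gh := mem_signed_perm (tperm i j) [ffun=> false].
set h := signed_perm _ _ in Gh.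
have hE x : h x = swap i j x by rewrite signed_permE ffunE addbF.
(* Adding the number of [w] that exchange [i] and [j] to both sides, and replacing it on the left by
   its negative counterpart, makes the identity hold term by term through [lt_swap]. *)
apply: (@addIn (\sum_(w in C)
       ((w (i, false) == (j, false)) && (w (j, false) == (i, false))))%N).
rewrite -{1}(sum_swapped ij').
rewrite mul2n -addnn -{2}(sum_conj CG _ Gh) -sum1_card -!big_split /=.
apply: eq_bigr => w /(class_hyperoct CG) Gw.
have -> : (w ^ h)%g (i, false) = swap i j (w (j, false)).
  by rewrite -hE -permJ hE /swap /= tpermR.
have -> : (w ^ h)%g (j, false) = swap i j (w (i, false)).
  by rewrite -hE -permJ hE /swap /= tpermL.
rewrite lt_swap //.
apply: contraNneq ij' => /(absfun_inj Gw) -> //.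
Qed.

End DescentSums.

(** * Total descent numbers over a class and over the whole group *)

Lemma desB_split m (w : {perm spoint m.+1}) :
  desB w = ((w (ord0, false)).2 + \sum_(i < m)
    (spoint_int (w (lift ord0 i, false))
       < spoint_int (w (widen_ord (leqnSn m) i, false)))%R)%N.
Proof.
rewrite /desB -sum1dep_card big_mkcond big_ord_recl; congr (_ + _)%N.
  by rewrite windowS -spoint_lt0; case: ifP.
apply: eq_bigr => i _; rewrite windowS.
by rewrite (windowS w (widen_ord (leqnSn m) i)); case: ifP.
Qed.

Lemma sum_numfix2 m (C : {set {perm spoint m.+1}}) w s :
  C \in classes (hyperoct m.+1) -> w \in C ->
  (m.+1 * \sum_(i < m) numfix2 C s (widen_ord (leqnSn m) i) (lift ord0 i)
   = #|C| * (nfix s w * (nfix s w).-1))%N.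
Proof.
move=> CG Cw; case: m => [|m] in C w CG Cw *.
  (* In B_1 there is no adjacent pair, and k(k-1) = 0 because k is at most 1. *)
  rewrite big_ord0 muln0; suff : (nfix s w <= 1)%N.
    by case: nfix => [|[]] // _; rewrite !muln0.
  by rewrite (leq_trans (max_card _)) ?card_ord.
have ne (i : 'I_m.+1) : widen_ord (leqnSn m.+1) i != lift ord0 i.
  by rewrite -val_eqE /= /bump /=; lia.
rewrite -(numfix2_total CG s Cw (ne ord0)).
rewrite (eq_bigr _ (fun i _ => numfix2_const CG s (ne i) (ne ord0))).
by rewrite sum_nat_const card_ord mulnA.
Qed.

(** The mean n/2 - (a^2 - b^2)/(2n), with denominators cleared and negative terms moved across so as
    to stay in [nat]. *)
Lemma sum_desB_class n (C : {set {perm spoint n}}) w :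
  (0 < n)%N -> C \in classes (hyperoct n) -> w \in C ->
  (2 * n * \sum_(v in C) desB v + #|C| * nfix false w ^ 2
   = #|C| * n ^ 2 + #|C| * nfix true w ^ 2)%N.
Proof.
case: n => // m in C w *; move=> _ CG Cw.
rewrite (eq_bigr _ (fun v _ => desB_split v)) big_split /= exchange_big /=.
have H0 := sum_neg_value CG ord0.
have : (\sum_(i < m) (2 * \sum_(v in C) (spoint_int (v (lift ord0 i, false))
       < spoint_int (v (widen_ord (leqnSn m) i, false)))%R
    + numfix2 C false (widen_ord (leqnSn m) i) (lift ord0 i)) =
  \sum_(i < m) (#|C|
    + numfix2 C true (widen_ord (leqnSn m) i) (lift ord0 i)))%N.
  by apply: eq_bigr => i _; apply: sum_descent.
rewrite big_split [RHS]big_split /= sum_nat_const card_ord -big_distrr /=.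
move=> H1.
(* The summand k comes from the descent at 0, and k(k-1) from the descents at positions i >= 1. *)
have sq k : (k ^ 2 = k + k * k.-1)%N by case: k => //= k; lia.
rewrite (sq (nfix false w)) (sq (nfix true w)) !mulnDr.
rewrite -!(numfix_total CG _ ord0 Cw) -!(sum_numfix2 _ CG Cw) -!mulnDr.
have -> : (#|C| * m.+1 ^ 2 = m.+1 * (#|C| + m * #|C|))%N by ring.
rewrite [(2 * _ * _)%N]mulnAC [(2 * _ * m.+1)%N]mulnC -!mulnDr.
by congr (_ * _)%N; rewrite mulnDr addnACA H0 H1 addnACA.
Qed.

Lemma sum_desB_hyperoct n :
  (2 * \sum_(w in hyperoct n) desB w = #|hyperoct n| * n)%N.
Proof.
pose g := signed_perm (1 : {perm 'I_n})%g [ffun=> true].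
have Gg : g \in hyperoct n := mem_signed_perm _ _.
have gE x : g x = spoint_opp x by rewrite signed_permE perm1 ffunE addbT.
rewrite mul2n -addnn {2}(reindex_inj (mulIg g)) /=.
rewrite (eq_bigl _ _ (fun w => groupMr w Gg)) -big_split -sum_nat_const /=.
apply: eq_bigr => w _; rewrite /desB.
have wg k : window (w * g)%g k = - window w k.
  case: k => [|k] /=; first by rewrite oppr0.
  case: insub => [i|]; last by rewrite oppr0.
  by rewrite permM gE spoint_int_opp.
(* Consecutive values never tie, also at w(0) = 0, so negation sends descents exactly to
   non-descents. *)
have wne (i : 'I_n) : window w i != window w i.+1.
  rewrite windowS; case: i => [[|k] lt_kn] /=.
    by rewrite eq_sym /spoint_int mulf_neq0 // signr_eq0.
  rewrite insubT ?(ltnW lt_kn) // => lt_k; rewrite (inj_eq (@spoint_int_inj n)).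
  by rewrite (inj_eq perm_inj) -pair_eqE /= -val_eqE /= andbT; lia.
rewrite -[RHS](card_ord n) -(cardsC [set i : 'I_n | window w i > window w i.+1]).
congr (_ + _)%N; apply: eq_card => i; rewrite !inE !wg ltrN2 -leNgt.
by rewrite lt_neqAle wne.
Qed.

(** * Values and derivatives at t = 1, and the theorem *)

Lemma des_poly1 n (S : {set {perm spoint n}}) : (des_poly S).[1] = #|S|%:R.
Proof.
rewrite /des_poly horner_sum -sumr_const; apply: eq_bigr => w _.
by rewrite hornerXn expr1n.
Qed.

Lemma deriv_des_poly1 n (S : {set {perm spoint n}}) :
  (des_poly S)^`().[1] = (\sum_(w in S) desB w)%:R + #|S|%:R.
Proof.
rewrite /des_poly raddf_sum horner_sum -sumr_const natr_sum -big_split /=.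
by apply: eq_bigr => w _; rewrite derivXn hornerMn hornerXn expr1n -natr1.
Qed.

Lemma dvd_sqr_1subX (R : comNzRingType) (p : {poly R}) :
  p.[1] = 0 -> p^`().[1] = 0 -> exists g, p = (1 - 'X) ^+ 2 * g.
Proof.
move=> /eqP /factor_theorem [q ->]; rewrite derivM derivXsubC mulr1 !hornerE.
rewrite subrr mulr0 add0r => /eqP /factor_theorem [r ->]; exists r.
by rewrite polyC1; ring.
Qed.

Theorem theorem5p11 (n : nat) (hn : (1 <= n)%N) (lambda mu : seq nat)
    (C : {set {perm spoint n}}) (hC : class_of_type C lambda mu) :
  exists g : {poly rat},
    (#|C|%:R)^-1 *: des_poly C =
      ((2 ^ n * n`!)%:R)^-1 *: eulerB n
      + (Delta2 lambda mu)%:~R *: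
          (((2 * n)%:R^-1 *: (1 - 'X)) *
           (((2 ^ n.-1 * (n.-1)`!)%:R)^-1 *: eulerB n.-1))
      + (1 - 'X) ^+ 2 * g.
Proof.
have [CG [w Cw wT]] := hC.
have [Ea Eb] := m1_cycle_type w; rewrite wT /= in Ea Eb.
have N0 : (#|C|%:R : rat) != 0.
  by rewrite pnatr_eq0 -lt0n; apply/card_gt0P; exists w.
have M0 k : ((2 ^ k * k`!)%:R : rat) != 0.
  by rewrite pnatr_eq0 -lt0n muln_gt0 expn_gt0 fact_gt0.
have n0 : (n%:R : rat) != 0 by rewrite pnatr_eq0 -lt0n.
set q := _ *: eulerB n.-1; set p := _ *: eulerB n + _.
have q1 : q.[1] = 1 by rewrite hornerZ des_poly1 card_hyperoct mulVf.
(* Since [q] is multiplied by 1 - t, only q(1) = 1 matters for the value and the derivative at 1. *)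
clearbody q; set d := des_poly C.
suff [g Eg] : exists g, (#|C|%:R)^-1 *: d - p = (1 - 'X) ^+ 2 * g.
  by exists g; rewrite -Eg addrC subrK.
apply: dvd_sqr_1subX.
  rewrite !hornerE /= q1 !des_poly1 card_hyperoct !mulVf //.
  by rewrite subrr !(mul0r, mulr0) addr0 subrr.
(* The derivatives at 1 are the means of des_B + 1; both descent totals are carried over to the
   rationals. *)
have HC := congr1 (fun k => k%:R : rat) (sum_desB_class hn CG Cw).
have HB := congr1 (fun k => k%:R : rat) (sum_desB_hyperoct n).
rewrite /= -{}Ea -{}Eb !(natrD, natrM, natrX) in HC.
rewrite /= !natrM card_hyperoct in HB.
rewrite /p !derivE !hornerE /= q1 !deriv_des_poly1 card_hyperoct /Delta2.
rewrite !rmorphB !rmorphXn /= -!pmulrn [(2 * n)%:R]natrM.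
set E := \sum_(v in hyperoct_set n) _; have M0n := M0 n.
move: M0n HC HB; set M := (2 ^ n * _)%:R.
set x := (\sum_(v in C) _)%:R => M0n HC HB.
clearbody M.
have Ey : E%:R = M * n%:R / 2 :> rat by rewrite -HB; field.
have Ex : x = (#|C|%:R * n%:R ^+ 2 + #|C|%:R * (m1 mu)%:R ^+ 2
               - #|C|%:R * (m1 lambda)%:R ^+ 2) / (2 * n%:R).
  by rewrite -HC; field.
by rewrite Ey Ex; field; rewrite ?N0 ?n0 ?M0n.
Qed.
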